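(* Let $\mathcal{S}\in\mathbb{M}$ be a favour-indifference background model with $0\in\mathcal{S}_{\mathrm{acc}}$, and let $\mathcal{M}$ be a favour-indifference assessment on $\mathcal{L}$. Then $\mathcal{M}\in\mathbb{M}$ and $\mathcal{S}\subseteq\mathcal{M}$ (i.e., $\mathcal{M}$ is a favour-indifference model without confusion dominating $\mathcal{S}$) if and only if all of the following hold: (FI1) $\mathcal{S}\subseteq\mathcal{M}$; (FI2) $0\notin\mathcal{M}_{\mathrm{fav}}$; (FI3) $\mathcal{M}_{\mathrm{fav}}$ is a cone and $\mathcal{M}_{\mathrm{ind}}$ is a linear subspace of $\mathcal{L}$; (FI4) $\mathcal{M}_{\mathrm{fav}}+\mathcal{M}_{\mathrm{ind}}\subseteq\mathcal{M}_{\mathrm{fav}}$.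
   Context: Let $\Omega$ be a non-empty set and let $\mathcal{L}$ be a real linear subspace of the vector space of all real-valued functions (''gambles'') on $\Omega$ with pointwise operations. For $\mathcal{K},\mathcal{K}'\subseteq\mathcal{L}$: $-\mathcal{K}=\{-f:f\in\mathcal{K}\}$; $\mathcal{K}+\mathcal{K}'=\{f+g:f\in\mathcal{K},g\in\mathcal{K}'\}$ (empty if either set is empty); $\mathcal{K}-\mathcal{K}'=\mathcal{K}+(-\mathcal{K}')$; $\overline{\mathcal{K}}=\{\lambda f:\lambda>0,f\in\mathcal{K}\}$; $\operatorname{posi}\mathcal{K}$ is the set of all linear combinations with strictly positive coefficients of non-empty finite families of elements of $\mathcal{K}$ (so $\operatorname{posi}\emptyset=\emptyset$). A cone is a set $\mathcal{K}\subseteq\mathcal{L}$ with $\operatorname{posi}\mathcal{K}=\mathcal{K}$. An assessment is a pair $\mathcal{A}=\langle\mathcal{A}_{\mathrm{acc}};\mathcal{A}_{\mathrm{rej}}\rangle$ of subsets of $\mathcal{L}$; inclusion is component-wise. Its favourable gambles are $\mathcal{A}_{\mathrm{fav}}=\mathcal{A}_{\mathrm{acc}}\cap-\mathcal{A}_{\mathrm{rej}}$ and its indifferent gambles are $\mathcal{A}_{\mathrm{ind}}=\mathcal{A}_{\mathrm{acc}}\cap-\mathcal{A}_{\mathrm{acc}}$. A favour-indifference assessment is one with $-\mathcal{A}_{\mathrm{rej}}\subseteq\mathcal{A}_{\mathrm{acc}}$ and $\mathcal{A}_{\mathrm{acc}}=\mathcal{A}_{\mathrm{fav}}\cup\mathcal{A}_{\mathrm{ind}}$.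 A model without confusion is an assessment $\mathcal{M}$ such that $\mathcal{M}_{\mathrm{acc}}\cap\mathcal{M}_{\mathrm{rej}}=\emptyset$, $\mathcal{M}_{\mathrm{acc}}$ is a cone, and $\overline{\mathcal{M}_{\mathrm{rej}}}\cup(\overline{\mathcal{M}_{\mathrm{rej}}}-\mathcal{M}_{\mathrm{acc}})\subseteq\mathcal{M}_{\mathrm{rej}}$. The set of these is $\mathbb{M}$. *)

(* Defs.v *)
From mathcomp Require Import all_boot all_order all_algebra.
From mathcomp Require Import boolp classical_sets functions reals.

Set Implicit Arguments.
Unset Strict Implicit.
Unset Printing Implicit Defensive.

Import Order.TTheory GRing.Theory Num.Theory.
Local Open Scope classical_set_scope.
Local Open Scope ring_scope.

(* The linear space L of gambles under consideration is a set of functions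
   closed under the pointwise linear structure that [functions] puts on
   [Omega -> R^o], where [R^o] is R as a vector space over itself; subsets of L
   are sets of functions included in L. *)

Section Gambles.
Variables (R : realType) (Omega : Type).

Implicit Types (K : set (Omega -> R^o)) (L V : set (Omega -> R^o)).

Definition is_linear_space V : Prop :=
  [/\ V 0,
      forall f g, V f -> V g -> V (f + g)
    & forall (a : R) f, V f -> V (a *: f)].

Definition is_subspace L V : Prop := V `<=` L /\ is_linear_space V.

Definition opp_set K : set (Omega -> R^o) := [set - f | f in K].

Definition add_set K K' : set (Omega -> R^o) := [set f + g | f in K & g in K'].

Definition sub_set K K' : set (Omega -> R^o) := add_set K (opp_set K').

Definition scaled K : set (Omega -> R^o) :=
  [set h | exists (a : R) (f : Omega -> R^o), [/\ 0 < a, K f & h = a *: f]].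

(* Families are indexed by 'I_n.+1, hence non-empty. *)
Definition posi K : set (Omega -> R^o) :=
  [set h | exists (n : nat) (a : 'I_n.+1 -> R) (f : 'I_n.+1 -> Omega -> R^o),
      [/\ forall i, 0 < a i, forall i, K (f i) & h = \sum_i a i *: f i]].

Definition is_cone L K : Prop := K `<=` L /\ posi K = K.

Record assessment := Assessment {
  acc : set (Omega -> R^o);
  rej : set (Omega -> R^o) }.

Implicit Types A M : assessment.

Definition assessment_on L A : Prop := acc A `<=` L /\ rej A `<=` L.

Definition assessment_le A B : Prop :=
  acc A `<=` acc B /\ rej A `<=` rej B.

Definition fav A : set (Omega -> R^o) := acc A `&` opp_set (rej A).

Definition ind A : set (Omega -> R^o) := acc A `&` opp_set (acc A).

Definition favour_indifference L A : Prop :=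
  [/\ assessment_on L A,
      opp_set (rej A) `<=` acc A
    & acc A = fav A `|` ind A].

Definition model_without_confusion L M : Prop :=
  [/\ assessment_on L M,
      acc M `&` rej M = set0,
      is_cone L (acc M)
    & scaled (rej M) `|` sub_set (scaled (rej M)) (acc M) `<=` rej M].

End Gambles.

(* Main.v *)
Require Import Defs.
From mathcomp Require Import all_boot all_order all_algebra.
From mathcomp Require Import boolp classical_sets functions reals.

Set Implicit Arguments.
Unset Strict Implicit.
Unset Printing Implicit Defensive.

Import Order.TTheory GRing.Theory Num.Theory.
Local Open Scope classical_set_scope.
Local Open Scope ring_scope.

(** For a favour-indifference assessment [M] the rejected gambles are exactly
    the negated favourable ones ([rejE]) and the acceptable gambles are those
    that are favourable or indifferent ([accE]), so [M] is determined by [fav M]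
    and [ind M].  Moreover a set is a cone precisely when it is closed under
    sums and positive scaling ([is_coneP]).  Both directions then translate
    between the two descriptions, through the inclusion of [fav M + acc M] in
    [fav M].

    If [M] is a model dominating [S], then rejecting [- f] and accepting [g]
    entails rejecting [- f - g], which is that inclusion ([model_favD]).  It
    absorbs indifferent gambles in particular, and it makes [fav M], which is
    closed under positive scaling, a cone.  The set [ind M] is the symmetric
    part of the cone [acc M], hence a linear space, as it contains [0], which
    [S] already accepts.

    Conversely, the inclusion follows from [fav M] being a cone that absorbs
    [ind M] ([favDacc]).  A gamble both accepted and rejected would thus make
    [0] favourable; and the inclusion, read for [- fav M], is the closure
    condition on the rejected gambles ([fi_model]). *)

Section Cones.
Variables (R : realType) (Omega : Type).
Implicit Types (K L : set (Omega -> R^o)) (M : assessment R Omega).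

Lemma opp_setE K f : opp_set K f <-> K (- f).
Proof.
split=> [[g Kg <-]|Kf]; first by rewrite opprK.
by exists (- f) => //; rewrite opprK.
Qed.

Lemma sub_posi K : K `<=` posi K.
Proof.
move=> f Kf; exists 0%N, (fun=> 1), (fun=> f); split=> //.
by rewrite big_ord1 scale1r.
Qed.

Lemma posiD K f g : K f -> K g -> posi K (f + g).
Proof.
move=> Kf Kg.
exists 1%N, (fun=> 1), (fun i : 'I_2 => if i == ord0 then f else g).
split=> // [i|]; first by case: ifP.
by rewrite big_ord_recl big_ord1 /= !scale1r.
Qed.

Lemma posiZ K (a : R) f : 0 < a -> K f -> posi K (a *: f).
Proof.
by move=> a0 Kf; exists 0%N, (fun=> a), (fun=> f); split=> //; rewrite big_ord1.
Qed.

Lemma posi_min K :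
  (forall f g, K f -> K g -> K (f + g)) ->
  (forall (a : R) f, 0 < a -> K f -> K (a *: f)) ->
  posi K `<=` K.
Proof.
move=> KD KZ _ [n [a [f [a0 Kf ->]]]].
elim: n a f a0 Kf => [|n IHn] a f a0 Kf; first by rewrite big_ord1; apply: KZ.
rewrite big_ord_recl; apply: KD; first exact: KZ.
exact: (IHn (fun i => a (lift ord0 i)) (fun i => f (lift ord0 i))).
Qed.

Lemma is_coneP L K :
  is_cone L K <->
  [/\ K `<=` L, forall f g, K f -> K g -> K (f + g)
    & forall (a : R) f, 0 < a -> K f -> K (a *: f)].
Proof.
split=> [[KL KE]|[KL KD KZ]].
  split=> // [f g Kf Kg|a f a0 Kf]; rewrite -KE; first exact: posiD.
  exact: posiZ.
by split=> //; apply/seteqP; split; [exact: posi_min|exact: sub_posi].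
Qed.

Lemma favE M f : fav M f <-> acc M f /\ rej M (- f).
Proof.
by split=> [[Af /opp_setE Rf]|[Af Rf]]; split=> //; apply/opp_setE.
Qed.

Lemma indE M f : ind M f <-> acc M f /\ acc M (- f).
Proof.
by split=> [[Af /opp_setE Rf]|[Af Rf]]; split=> //; apply/opp_setE.
Qed.

(** Rejected gambles have acceptable negations here, so that rejecting a gamble
    amounts to favouring its negation. *)
Lemma rejE L M f : favour_indifference L M -> rej M f <-> fav M (- f).
Proof.
move=> [_ oppR _]; rewrite favE opprK; split=> [Rf|[]//].
by split=> //; apply: oppR; exists f.
Qed.

Lemma accE L M f : favour_indifference L M -> acc M f <-> fav M f \/ ind M f.
Proof. by case=> _ _ {1}->. Qed.

Lemma rejZ L M (a : R) f :
  model_without_confusion L M -> 0 < a -> rej M f -> rej M (a *: f).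
Proof. by move=> [_ _ _ sub] a0 Rf; apply: sub; left; exists a, f. Qed.

Lemma rejB L M f g :
  model_without_confusion L M -> rej M f -> acc M g -> rej M (f - g).
Proof.
move=> [_ _ _ sub] Rf Ag; apply: sub; right.
exists f; first by exists 1, f; split=> //; rewrite scale1r.
by exists (- g) => //; exists g.
Qed.

Lemma model_favD L M f g :
  model_without_confusion L M -> fav M f -> acc M g -> fav M (f + g).
Proof.
move=> Mm /favE[Af Rf] Ag; apply/favE; split.
  by case: Mm => _ _ /is_coneP[_ AD _] _; apply: AD.
by rewrite opprD; apply: rejB Mm Rf Ag.
Qed.

Lemma model_fav_cone L M : model_without_confusion L M -> is_cone L (fav M).
Proof.
move=> Mm; have [[AL _] _ /is_coneP[_ _ AZ] _] := Mm.
apply/is_coneP; split=> [f /favE[/AL]//|f g Ff /favE[Ag _]|a f a0 /favE[Af Rf]].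
  exact: model_favD Mm Ff Ag.
by apply/favE; split; [exact: AZ|rewrite -scalerN; exact: rejZ Mm a0 Rf].
Qed.

Lemma model_ind_subspace L M :
  model_without_confusion L M -> acc M 0 -> is_subspace L (ind M).
Proof.
move=> [[AL _] _ /is_coneP[_ AD AZ] _] A0; split=> [f /indE[/AL]//|].
split=> [|f g /indE[Af ANf] /indE[Ag ANg]|a f /indE[Af ANf]]; apply/indE.
- by rewrite oppr0.
- by rewrite opprD; split; apply: AD.
case: (ltgtP 0 a) => [a0|a0|<-].
- by rewrite -scalerN; split; apply: AZ.
- (* [a *: f] and its negation are positive multiples of [- f] and [f]. *)
  have Na0 : 0 < - a by rewrite oppr_gt0.
  by split; [rewrite -[f]opprK scalerN -scaleNr|rewrite -scaleNr]; apply: AZ.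
- by rewrite scale0r oppr0.
Qed.

(** If the cone of favourable gambles absorbs the indifferent ones, it absorbs
    all acceptable ones. *)
Lemma favDacc L M f g :
  favour_indifference L M -> is_cone L (fav M) ->
  add_set (fav M) (ind M) `<=` fav M ->
  fav M f -> acc M g -> fav M (f + g).
Proof.
move=> Mfi /is_coneP[_ FD _] FI Ff /(accE _ Mfi)[Fg|Ig]; first exact: FD.
by apply: FI; exists f => //; exists g.
Qed.

Lemma fi_acc_cone L M :
  favour_indifference L M -> is_cone L (fav M) -> is_subspace L (ind M) ->
  add_set (fav M) (ind M) `<=` fav M -> is_cone L (acc M).
Proof.
move=> Mfi Fcone [_ [_ ID IZ]] FI; have [[AL _] _ _] := Mfi.
have /is_coneP[_ _ FZ] := Fcone.
apply/is_coneP; split=> // [f g Af Ag|a f a0 /(accE _ Mfi)[Ff|If]].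
- have [Ff|If] := (accE _ Mfi).1 Af.
    by apply/(accE _ Mfi); left; apply: favDacc Mfi Fcone FI Ff Ag.
  have [Fg|Ig] := (accE _ Mfi).1 Ag; apply/(accE _ Mfi).
    by left; rewrite addrC; apply: favDacc Mfi Fcone FI Fg Af.
  by right; apply: ID.
- by apply/(accE _ Mfi); left; apply: FZ.
- by apply/(accE _ Mfi); right; apply: IZ.
Qed.

Lemma fi_model L M :
  favour_indifference L M -> ~ fav M 0 ->
  is_cone L (fav M) -> is_subspace L (ind M) ->
  add_set (fav M) (ind M) `<=` fav M -> model_without_confusion L M.
Proof.
move=> Mfi NF0 Fcone Isub FI; have [Mon _ _] := Mfi.
have FA f g := @favDacc L M f g Mfi Fcone FI.
have /is_coneP[_ _ FZ] := Fcone.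
have RZ (a : R) f : 0 < a -> rej M f -> fav M (- (a *: f)).
  by move=> a0 /(rejE _ Mfi) Ff; rewrite -scalerN; apply: FZ.
split=> //; last 2 first.
- exact: fi_acc_cone Mfi Fcone Isub FI.
- move=> h [[a [f [a0 Rf ->]]]|]; first by apply/(rejE _ Mfi)/RZ.
  move=> [_ [a [f [a0 Rf ->]]] [_ [g Ag <-] <-]].
  by apply/(rejE _ Mfi); rewrite opprB addrC; apply: FA => //; apply: RZ.
- rewrite -subset0 => f [Af /(rejE _ Mfi) Ff].
  by apply: NF0; rewrite -(addNr f); apply: FA.
Qed.

End Cones.

Theorem theorem4p11 (R : realType) (Omega : Type) (Omega_ne : inhabited Omega)
    (L : set (Omega -> R^o)) (L_lin : is_linear_space L)
    (S : assessment R Omega)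
    (S_model : model_without_confusion L S)
    (S_fi : favour_indifference L S)
    (S_0 : acc S 0)
    (M : assessment R Omega)
    (M_fi : favour_indifference L M) :
  (model_without_confusion L M /\ assessment_le S M)
  <->
  [/\ (* FI1 *) assessment_le S M,
      (* FI2 *) ~ fav M 0,
      (* FI3 *) is_cone L (fav M) /\ is_subspace L (ind M)
    & (* FI4 *) add_set (fav M) (ind M) `<=` fav M].
Proof.
split=> [[Mm SM]|[SM NF0 [Fcone Isub] FI]]; last first.
  by split=> //; apply: fi_model.
split=> //.
- move=> /favE[A0]; rewrite oppr0 => R0; case: Mm => _ disj _ _.
  have : (acc M `&` rej M) 0 by [].
  by rewrite disj.
- split; first exact: model_fav_cone.
  by apply: model_ind_subspace => //; apply: SM.1.
- by move=> _ [f Ff [g /indE[Ag _] <-]]; apply: model_favD Mm Ff Ag.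
Qed.
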